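(* Let $n\ge 1$, let $Q\in\mathbb{R}^{n\times n}$ be symmetric and $\bm{c}\in\mathbb{R}^n$. Let $\hat r\in\mathbb{R}$ be such that the set $\mathcal{D}=\{\bm{u}\in\mathbb{R}^n : F([\bm{u},\hat r])\succeq 0\}$ has positive $n$-dimensional volume, and let $f_{\hat r}:\mathcal{D}\to\mathbb{R}$ be defined by $f_{\hat r}(\bm{u})=\inf\{t\in\mathbb{R} : F([\bm{u},\hat r]+t e_{n+1})\succeq 0\}$. Let $\bm{u}^*\in\mathcal{D}$. Then $[\bm{u}^*,\hat r+f_{\hat r}(\bm{u}^* )]\in\mathbb{R}^{n+1}$ is an optimal solution of the semidefinite program $$\min_{r\in\mathbb{R},\,\bm{u}\in\mathbb{R}^n}\ r\quad\text{subject to}\quad F([\bm{u},r])\succeq 0$$ if and only if $\bm{u}^*$ is an optimal solution of the problem $$\min\ f_{\hat r}(\bm{u})\quad\text{subject to}\quad \bm{u}\in\mathcal{D}.$$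
   Context: For $\bm{u}\in\mathbb{R}^n$ and $r\in\mathbb{R}$, $[\bm{u},r]\in\mathbb{R}^{n+1}$ denotes the vector whose first $n$ coordinates are those of $\bm{u}$ and whose last coordinate is $r$; $e_{n+1}$ is the $(n+1)$-th standard basis vector of $\mathbb{R}^{n+1}$, so $[\bm{u},\hat r]+te_{n+1}=[\bm{u},\hat r+t]$. Given a symmetric $Q\in\mathbb{R}^{n\times n}$ and $\bm{c}\in\mathbb{R}^n$, define the symmetric $(n+1)\times(n+1)$ matrix $$F([\bm{u},r])=\begin{bmatrix} r & -(\bm{c}+\bm{u})^T/2\\ -(\bm{c}+\bm{u})/2 & \mathrm{diag}(\bm{u})-Q\end{bmatrix},$$ where $\mathrm{diag}(\bm{u})$ is the diagonal matrix with diagonal $\bm{u}$. $M\succeq 0$ means that $M$ is positive semidefinite. The set $\mathcal{D}$ is the intersection of the feasible region $\mathcal{S}=\{\bm{y}\in\mathbb{R}^{n+1}:F(\bm{y})\succeq 0\}$ with the hyperplane $\mathcal{H}=\{[\bm{u},\hat r]:\bm{u}\in\mathbb{R}^n\}$, identified with a subset of $\mathbb{R}^n$ by dropping the last coordinate. An optimal solution is a feasible point attaining the minimum. *)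

(* Defs.v *)
From mathcomp Require Import all_boot all_order all_algebra.
From mathcomp Require Import all_classical all_reals all_analysis.
Set Implicit Arguments.
Unset Strict Implicit.
Unset Printing Implicit Defensive.
Import Order.TTheory GRing.Theory Num.Theory.
Local Open Scope classical_set_scope.
Local Open Scope ring_scope.

Section Definitions.
Variable R : realType.

Definition psd (m : nat) (M : 'M[R]_m) : Prop :=
  M^T = M /\ forall x : 'cV[R]_m, 0 <= (x^T *m M *m x) 0 0.

Definition minimizer (T : Type) (S : set T) (g : T -> R) (x : T) : Prop :=
  S x /\ forall y, S y -> g x <= g y.

Definition box (n : nat) (a b : 'cV[R]_n) : set 'cV[R]_n :=
  [set x | forall i, a i 0 <= x i 0 <= b i 0].

(* The maximum with 0 gives empty boxes volume 0. *)
Definition box_volume (n : nat) (a b : 'cV[R]_n) : R :=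
  \prod_(i < n) Num.max 0 (b i 0 - a i 0).

(* n-dimensional Lebesgue outer measure, by countable covers by closed boxes.
   It agrees with Lebesgue measure on Lebesgue measurable sets, in particular
   on closed sets such as [slice] below. *)
Definition volume (n : nat) (A : set 'cV[R]_n) : \bar R :=
  ereal_inf [set v | exists a b : nat -> 'cV[R]_n,
    A `<=` \bigcup_k box (a k) (b k) /\
    v = (\sum_(0 <= k <oo) (box_volume (a k) (b k))%:E)%E].

Variable n : nat.

(* the vector [u, r] of R^{n+1} *)
Definition uvec (u : 'cV[R]_n) (r : R) : 'cV[R]_(n + 1) := col_mx u r%:M.

Definition last_coord (y : 'cV[R]_(n + 1)) : R := dsubmx y 0 0.

(* the standard basis vector e_{n+1} *)
Definition e_last : 'cV[R]_(n + 1) := delta_mx (rshift n ord0) 0.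

Variables (Q : 'M[R]_n) (c : 'cV[R]_n).

Definition F (y : 'cV[R]_(n + 1)) : 'M[R]_(1 + n) :=
  let u := usubmx y in
  block_mx (last_coord y)%:M         (- (2^-1 *: (c + u)^T))
           (- (2^-1 *: (c + u)))     (diag_mx u^T - Q).

Definition feasible : set 'cV[R]_(n + 1) := [set y | psd (F y)].

(* The set D of the hyperplane at height [r], in R^n. *)
Definition slice (r : R) : set 'cV[R]_n := [set u | feasible (uvec u r)].

(* For [u] in [slice r] the set contains 0 and is bounded below by [- r], the
   (1,1) entry of a psd matrix being nonnegative; so the real-valued [inf],
   which has a default value elsewhere, is the true infimum there. *)
Definition fdepth (r : R) (u : 'cV[R]_n) : R :=
  inf [set t : R | psd (F (uvec u r + t *: e_last))].

End Definitions.

(* Main.v *)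
(* The feasible region is upward closed in [r], and the infimum defining
   [fdepth] is attained because, for each fixed vector [x], positivity of
   [x^T F x] is a closed affine condition on [r].  So [rhat + fdepth u] is the
   least feasible height above [u]; a feasible point at height at most [rhat]
   lies over [D], and one at height above [rhat] cannot beat [ustar], since
   [fdepth] is nonpositive on [D]. *)

Require Import Defs.
From mathcomp Require Import all_boot all_order all_algebra.
From mathcomp Require Import all_classical all_reals all_analysis.
Set Implicit Arguments.
Unset Strict Implicit.
Unset Printing Implicit Defensive.
Import Order.TTheory GRing.Theory Num.Theory.
Local Open Scope classical_set_scope.
Local Open Scope ring_scope.

Lemma uvecD_last (R : realType) (n : nat) (u : 'cV[R]_n) (r t : R) :
  uvec u r + t *: e_last R n = uvec u (r + t).
Proof.
apply/matrixP => i j; rewrite /uvec /e_last (ord1 j) mxE [X in _ + X]mxE.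
rewrite -(fintype.splitK i); case: (fintype.split i) => k /=.
  by rewrite !col_mxEu !mxE eq_lrshift mulr0 addr0.
by rewrite !col_mxEd !mxE (ord1 k) !eqxx mulr1.
Qed.

Lemma last_coord_uvec (R : realType) (n : nat) (u : 'cV[R]_n) (r : R) :
  last_coord (uvec u r) = r.
Proof. by rewrite /last_coord /uvec col_mxKd mxE mulr1n. Qed.

Lemma uvec_surj (R : realType) (n : nat) (y : 'cV[R]_(n + 1)) :
  uvec (usubmx y) (last_coord y) = y.
Proof. by rewrite /uvec /last_coord -mx11_scalar vsubmxK. Qed.

(** Every vector of R^{n+1} splits as a base point and a height, so competitors in the program can
    be taken in the form [uvec v s]. *)
Lemma minimizer_last_coord (R : realType) (n : nat) (S : set 'cV[R]_(n + 1))
    (u : 'cV[R]_n) (r : R) :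
  minimizer S (@last_coord R n) (uvec u r) <->
  S (uvec u r) /\ forall v s, S (uvec v s) -> r <= s.
Proof.
split=> -[Sur opt]; split=> //.
  by move=> v s /opt; rewrite !last_coord_uvec.
by move=> y; rewrite last_coord_uvec -{1}(uvec_surj y); exact: opt.
Qed.

Lemma F_uvecD (R : realType) (n : nat) (Q : 'M[R]_n) (c u : 'cV[R]_n) (r t : R) :
  F Q c (uvec u (r + t)) = F Q c (uvec u r) + t *: delta_mx (lshift n ord0) (lshift n ord0).
Proof.
have -> : t *: delta_mx (lshift n ord0) (lshift n ord0) = block_mx t%:M 0 0 0 :> 'M[R]_(1 + n).
  apply/matrixP => i j.
  rewrite -(fintype.splitK i) -(fintype.splitK j); case: (fintype.split i) => a; case: (fintype.split j) => b /=.
  - by rewrite block_mxEul !mxE (ord1 a) (ord1 b) !eqxx mulr1.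
  - by rewrite block_mxEur !mxE eq_rlshift andbF mulr0.
  - by rewrite block_mxEdl !mxE eq_rlshift mulr0.
  - by rewrite block_mxEdr !mxE eq_rlshift mulr0.
rewrite /F !last_coord_uvec /uvec !col_mxKu add_block_mx !addr0.
by rewrite -raddfD.
Qed.

(** The height enters [F] only in the (1,1) entry, so for fixed [x] the form is affine in it, and
    the slope is a square: its sign gives upward closure, its affinity attainment. *)
Lemma quad_F_uvecD (R : realType) (n : nat) (Q : 'M[R]_n) (c u : 'cV[R]_n)
    (r t : R) (x : 'cV[R]_(1 + n)) :
  (x^T *m F Q c (uvec u (r + t)) *m x) 0 0 =
  (x^T *m F Q c (uvec u r) *m x) 0 0 + t * x (lshift n ord0) 0 ^+ 2.
Proof.
rewrite F_uvecD mulmxDr mulmxDl mxE -scalemxAr -scalemxAl; congr (_ + _).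
(* The matrix unit is a column times a row; each factor picks out the first coordinate of [x]. *)
rewrite mxE -(mul_delta_mx (0 : 'I_1)) -!mulmxA mulmxA -rowE -colE.
by rewrite mxE big_ord1 !mxE expr2.
Qed.

(** Two heights differ by a multiple of a diagonal matrix unit, so the symmetry included in [psd]
    carries over. *)
Lemma F_uvec_sym (R : realType) (n : nat) (Q : 'M[R]_n) (c u : 'cV[R]_n) (r t : R) :
  (F Q c (uvec u r))^T = F Q c (uvec u r) ->
  (F Q c (uvec u t))^T = F Q c (uvec u t).
Proof.
by rewrite -(subrKC r t) F_uvecD raddfD /= linearZ /= trmx_delta => ->.
Qed.

Lemma feasible_uvec_le (R : realType) (n : nat) (Q : 'M[R]_n) (c u : 'cV[R]_n)
    (r t : R) :
  r <= t -> feasible Q c (uvec u r) -> feasible Q c (uvec u t).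
Proof.
move=> le_rt [symF posF]; split; first exact: F_uvec_sym symF.
move=> x; rewrite -(subrKC r t) quad_F_uvecD.
by rewrite addr_ge0 ?posF // mulr_ge0 ?sqr_ge0 // subr_ge0.
Qed.

Lemma feasible_height_ge0 (R : realType) (n : nat) (Q : 'M[R]_n)
    (c u : 'cV[R]_n) (r : R) :
  feasible Q c (uvec u r) -> 0 <= r.
Proof.
(* Testing on the first basis vector isolates the (1,1) entry. *)
case=> _ /(_ (delta_mx (lshift n ord0) 0)).
rewrite trmx_delta -mulmxA -colE -rowE mxE mxE.
by rewrite /F block_mxEul last_coord_uvec mxE mulr1n.
Qed.

Lemma fdepth_set (R : realType) (n : nat) (Q : 'M[R]_n) (c u : 'cV[R]_n) (r : R) :
  [set t : R | psd (F Q c (uvec u r + t *: e_last R n))] =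
  [set t : R | feasible Q c (uvec u (r + t))].
Proof. by apply/seteqP; split => t; rewrite /= uvecD_last. Qed.

Lemma fdepth_le (R : realType) (n : nat) (Q : 'M[R]_n) (c u : 'cV[R]_n) (r t : R) :
  feasible Q c (uvec u (r + t)) -> fdepth Q c r u <= t.
Proof.
move=> feas_t; rewrite /fdepth fdepth_set; apply: ge_inf => //.
(* [inf] bounds its set from below only if a lower bound exists; here feasible heights [r + s] are
   nonnegative. *)
exists (- r) => s /= /feasible_height_ge0.
by rewrite -lerBlDl sub0r.
Qed.

Lemma feasible_fdepth (R : realType) (n : nat) (Q : 'M[R]_n) (c u : 'cV[R]_n)
    (r : R) :
  slice Q c r u -> feasible Q c (uvec u (r + fdepth Q c r u)).
Proof.
move=> Du; case: (Du) => symF posF; split; first exact: F_uvec_sym symF.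
move=> x; rewrite quad_F_uvecD.
(* If the first coordinate vanishes, the form does not depend on the height. *)
have [->|x0_neq0] := eqVneq (x (lshift n ord0) 0) 0.
  by rewrite expr0n mulr0 addr0 posF.
have x2_gt0 : 0 < x (lshift n ord0) 0 ^+ 2 by rewrite exprn_even_gt0.
(* Otherwise nonnegativity is a lower bound on the shift. Every feasible [t] obeys it, hence so does
   the infimum. *)
rewrite -lerBlDl sub0r -ler_pdivrMr // /fdepth fdepth_set.
apply: lb_le_inf; first by exists 0; rewrite /= addr0.
move=> t [_ /(_ x)]; rewrite quad_F_uvecD.
by rewrite -lerBlDl sub0r -ler_pdivrMr.
Qed.

Theorem theorem1 (R : realType) (n : nat) (n_ge1 : (1 <= n)%N)
    (Q : 'M[R]_n) (Q_sym : Q^T = Q) (c : 'cV[R]_n) (rhat : R)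
    (D_vol : (0 < volume (slice Q c rhat))%E)
    (ustar : 'cV[R]_n) (ustar_D : slice Q c rhat ustar) :
  minimizer (feasible Q c) (@last_coord R n)
    (uvec ustar (rhat + fdepth Q c rhat ustar))
  <-> minimizer (slice Q c rhat) (fdepth Q c rhat) ustar.
Proof.
rewrite minimizer_last_coord; split=> [[_ opt]|[_ opt]].
  split; first exact: ustar_D.
  by move=> u Du; rewrite -(lerD2l rhat); exact: opt (feasible_fdepth Du).
split; first exact: feasible_fdepth.
move=> u r feas_ur; have [le_r|lt_r] := leP r rhat.
  rewrite -lerBrDl; apply: le_trans (opt u (feasible_uvec_le le_r feas_ur)) _.
  (* The shift [r - rhat] is admissible over [u]. *)
  by apply: fdepth_le; rewrite subrKC.
apply: le_trans (ltW lt_r); rewrite gerDl.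
(* The zero shift is admissible over [ustar]. *)
apply: fdepth_le; rewrite addr0; exact: ustar_D.
Qed.
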